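(* For each $n\ge 0$ there is a unique $C_n\in\mathbb{Z}/2[t]$ such that $(U+I)\big((r^2+r)r^{2n}\big)=(r^2+r)\,C_n(r^2)$. These polynomials satisfy: (a) $C_{n+4}=C_{n+3}+(t^4+t^3+t^2+t)C_n+t^n(t^2+t)$ for all $n\ge0$; (b) $C_0=0$, $C_1=1$, $C_2=t$, $C_3=t^2$.
   Context: $\mathbb{Z}/2[r]$ and $\mathbb{Z}/2[t]$ are polynomial rings over the field with two elements. Let $F=r(r+1)^3$ and $G=r^3(r+1)$. $\mathbb{Z}/2[r]$ is a free $\mathbb{Z}/2[G]$-module with basis $1,r,r^2,r^3$. Let $U:\mathbb{Z}/2[r]\to\mathbb{Z}/2[r]$ be the map $U\big(\sum_{i=0}^3 g_i(G)r^i\big)=\sum_{i=0}^3 g_i(F)\,U(r^i)$ (for $g_i\in\mathbb{Z}/2[T]$), where $U(1)=1$, $U(r)=r$, $U(r^2)=r^2$, $U(r^3)=r^3+r^2+r$; thus $U$ is $\mathbb{Z}/2$-linear and $U(Gf)=FU(f)$. $I$ is the identity. *)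

(* Defs.v *)
From mathcomp Require Import all_boot all_order all_algebra.

Set Implicit Arguments.
Unset Strict Implicit.
Unset Printing Implicit Defensive.

Import GRing.Theory.
Local Open Scope ring_scope.

(* 'X stands for r in Z/2[r] and for t in Z/2[t]. *)
Definition F : {poly 'F_2} := 'X * ('X + 1) ^+ 3.
Definition G : {poly 'F_2} := 'X ^+ 3 * ('X + 1).

(* The coordinates g_i of f in the basis 1, r, r^2, r^3 of Z/2[r] over Z/2[G],
   read off from the base-G expansion of f (G is monic of degree 4):
   f = \sum_k d_k G^k with d_k = (f %/ G^k) %% G of degree < 4, and g_i collects
   the coefficients of r^i in the digits d_k. Digits with k >= size f vanish.
   See Gcoord_expansion and Gcoord_unique. *)
Definition Gcoord (f : {poly 'F_2}) (i : 'I_4) : {poly 'F_2} :=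
  \poly_(k < size f) ((f %/ G ^+ k) %% G)`_i.

Definition Ubasis (i : 'I_4) : {poly 'F_2} :=
  [:: 1; 'X; 'X^2; 'X^3 + 'X^2 + 'X]`_i.

Definition U (f : {poly 'F_2}) : {poly 'F_2} :=
  \sum_(i < 4) (Gcoord f i \Po F) * Ubasis i.

Lemma monicG : G \is monic.
Proof. by rewrite /G rpredM ?monicXn // -[1]opprK -polyCN monicXsubC. Qed.

Lemma size_G : size G = 5.
Proof.
rewrite /G -[1]opprK -polyCN size_Mmonic ?monicXsubC ?size_polyXn ?size_XsubC //.
by rewrite -size_poly_gt0 size_polyXn.
Qed.

Lemma G_neq0 : G != 0.
Proof. by rewrite monic_neq0 ?monicG. Qed.

Lemma Gcoord_coef f i k : (Gcoord f i)`_k = ((f %/ G ^+ k) %% G)`_i.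
Proof.
rewrite coef_poly; case: ltnP => // le_fk.
rewrite divp_small ?mod0p ?coef0 //.
have := size_exp G k; rewrite size_G => e.
have: (0 < size (G ^+ k))%N by rewrite size_poly_gt0 expf_neq0 ?G_neq0.
move=> h; rewrite -(prednK h) e ltnS (leq_trans le_fk) //.
by rewrite leq_pmull.
Qed.

Lemma Gcoord_rec f i : Gcoord f i = Gcoord (f %/ G) i * 'X + ((f %% G)`_i)%:P.
Proof.
apply/polyP=> k; rewrite coefD coefMX coefC !Gcoord_coef.
case: k => [|k] /=; first by rewrite expr0 divp1 add0r.
by rewrite addr0 exprS divp_divl.
Qed.

Lemma Gcomb_rec (g : 'I_4 -> {poly 'F_2}) (c : 'I_4 -> 'F_2) (H : {poly 'F_2})
    (b : 'I_4 -> {poly 'F_2}) :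
  \sum_(i < 4) ((g i * 'X + (c i)%:P) \Po H) * b i =
  (\sum_(i < 4) (g i \Po H) * b i) * H + \sum_(i < 4) c i *: b i.
Proof.
rewrite mulr_suml -big_split /=; apply: eq_bigr => i _.
by rewrite comp_polyD comp_polyM comp_polyX comp_polyC mulrDl mul_polyC mulrAC.
Qed.

Lemma size_digit (c : 'I_4 -> 'F_2) :
  (size (\sum_(i < 4) c i *: 'X^i)%R < size G)%N.
Proof.
rewrite size_G ltnS; apply: leq_trans (size_sum _ _ _) _.
apply/bigmax_leqP=> i _; apply: leq_trans (size_scale_leq _ _) _.
by rewrite size_polyXn.
Qed.

Lemma Gcoord_expansion f : f = \sum_(i < 4) (Gcoord f i \Po G) * 'X^i.
Proof.
elim: {f}(size f) {-2}f (leqnn (size f)) => [|n IHn] f le_f.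
  move: le_f; rewrite leqn0 size_poly_eq0 => /eqP ->.
  rewrite big1 // => i _; suff ->: Gcoord 0 i = 0 by rewrite comp_poly0 mul0r.
  by apply/polyP=> k; rewrite Gcoord_coef div0p mod0p !coef0.
under eq_bigr => i _ do rewrite Gcoord_rec.
rewrite Gcomb_rec -IHn; last first.
  rewrite size_divp ?G_neq0 // size_G leq_subLR (leq_trans le_f) //.
  by rewrite addSn ltnS leq_addl.
have ->: \sum_(i < 4) (f %% G)`_i *: 'X^i = f %% G; last exact: divp_eq.
rewrite -(poly_def 4 (fun i => (f %% G)`_i)).
apply/polyP=> k; rewrite coef_poly; case: ltnP => // le_k.
rewrite nth_default // (leq_trans _ le_k) //.
by have := ltn_modp f G; rewrite G_neq0 size_G ltnS.
Qed.

Lemma coef_digit (c : 'I_4 -> 'F_2) (i : 'I_4) :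
  (\sum_(j < 4) c j *: 'X^j)`_i = c i.
Proof.
rewrite coef_sum (bigD1 i) //= coefZ coefXn eqxx mulr1 big1 ?addr0 // => j.
by rewrite coefZ coefXn eq_sym -val_eqE => /negPf ->; rewrite mulr0.
Qed.

Lemma Gcoord_unique (g : 'I_4 -> {poly 'F_2}) :
  Gcoord (\sum_(i < 4) (g i \Po G) * 'X^i) =1 g.
Proof.
move=> i; apply/polyP=> k.
elim: k g => [|k IHk] g;
  have eg (j : 'I_4) : g j = drop_poly 1 (g j) * 'X + ((g j)`_0)%:P
    by rewrite -{1}(poly_take_drop 1 (g j)) addrC /take_poly poly_def big_ord1
               expr0 alg_polyC expr1.
all: under eq_bigr => j _ do rewrite eg.
all: rewrite Gcomb_rec Gcoord_rec coefD coefMX coefC /=.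
  rewrite add0r modpD modp_mull add0r modp_small ?size_digit //.
  by rewrite (coef_digit (fun j => (g j)`_0)).
rewrite addr0 divpD mulpK ?G_neq0 // divp_small ?size_digit // addr0.
by rewrite (IHk (fun j => drop_poly 1 (g j))) coef_drop_poly addn1.
Qed.

Lemma U_expansion (g : 'I_4 -> {poly 'F_2}) :
  U (\sum_(i < 4) (g i \Po G) * 'X^i) = \sum_(i < 4) (g i \Po F) * Ubasis i.
Proof. by apply: eq_bigr => i _; rewrite Gcoord_unique. Qed.

(* Main.v *)
(* With t = r^2, squaring G = r^4 + r^3 gives r^8 = r^6 + G^2, so f_n = (r^2 + r) r^(2n)
   satisfies f_(n+4) = f_(n+3) + G^2 f_n.  As U carries multiplication by G to
   multiplication by F, (U + I) f_n obeys the same recursion with G^2 replaced by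
   F^2 = t^4 + t^3 + t^2 + t, up to the inhomogeneous term (F + G)^2 f_n = (t^2 + t) f_n.
   Cancelling r^2 + r gives (a); the cases n < 4 are computed directly. *)
Require Import Defs.
From mathcomp Require Import all_boot all_order all_algebra.
From mathcomp Require Import ring.

Set Implicit Arguments.
Unset Strict Implicit.
Unset Printing Implicit Defensive.

Import GRing.Theory.
Local Open Scope ring_scope.

Lemma polyF2_2 : 2 = 0 :> {poly 'F_2}.
Proof. by rewrite -polyC_natr -polyC0; congr (_%:P); apply/val_inj. Qed.

(* [ring] does not know that 2 = 0, so identities mod 2 carry an explicit multiple of 2. *)
Lemma eq_mod2 (p q s : {poly 'F_2}) : p = q + 2 * s -> p = q.
Proof. by rewrite polyF2_2 mul0r addr0. Qed.

(** Quotients and remainders by a fixed polynomial are additive, so base-[G] digits add without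
    carries. *)
Lemma U_add : {morph U : p q / p + q}.
Proof.
move=> p q; rewrite /U -big_split /=; apply: eq_bigr => i _.
suff ->: Gcoord (p + q) i = Gcoord p i + Gcoord q i by rewrite comp_polyD mulrDl.
by apply/polyP=> k; rewrite coefD !Gcoord_coef divpD modpD coefD.
Qed.

(** Multiplying by [G] shifts the base-[G] digits up one place, with 0 at the bottom: each
    coordinate gains a factor ['X], which composition with [F] turns into [F]. *)
Lemma U_mulG p : U (G * p) = F * U p.
Proof.
rewrite /U mulr_sumr; apply: eq_bigr => i _.
rewrite Gcoord_rec mulKp ?G_neq0 // modp_mulr coef0 addr0.
by rewrite comp_polyM comp_polyX mulrAC mulrC.
Qed.

Lemma U_small (p : {poly 'F_2}) : (size p <= 4)%N -> U p = \sum_(i < 4) p`_i *: Ubasis i.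
Proof.
move=> le_p; have lt_pG: (size p < size G)%N by rewrite size_G ltnS.
apply: eq_bigr => i _; rewrite Gcoord_rec divp_small // modp_small //.
suff ->: Gcoord 0 i = 0 by rewrite mul0r add0r comp_polyC mul_polyC.
by apply/polyP=> k; rewrite Gcoord_coef div0p mod0p !coef0.
Qed.

Lemma U_Xn (i : 'I_4) : U 'X^i = Ubasis i.
Proof.
rewrite U_small ?size_polyXn // (bigD1 i) //= coefXn eqxx scale1r big1 ?addr0 //.
by move=> j; rewrite coefXn -val_eqE => /negPf ->; rewrite scale0r.
Qed.

Lemma comp_poly_X2_inj : injective (fun p : {poly 'F_2} => p \Po 'X^2).
Proof.
move=> p q /= eq_pq; apply/polyP=> i.
have /(congr1 (fun s : {poly 'F_2} => s`_(2 * i))) := eq_pq.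
by rewrite !coef_comp_poly_Xn // dvdn_mulr // mulKn.
Qed.

Lemma X2X_neq0 : 'X^2 + 'X != 0 :> {poly 'F_2}.
Proof.
by apply/eqP=> /(congr1 (fun s : {poly 'F_2} => s`_1)); rewrite coefD coefXn coefX coef0.
Qed.

Definition is_C (n : nat) (C : {poly 'F_2}) : Prop :=
  (U \+ id) (('X^2 + 'X) * 'X^(2 * n)) = ('X^2 + 'X) * (C \Po 'X^2).

(** Besides uniqueness, this yields (a) and (b): it suffices that both sides satisfy [is_C] at the
    same index. *)
Lemma is_C_inj n C D : is_C n C -> is_C n D -> C = D.
Proof. by rewrite /is_C => -> /(mulfI X2X_neq0) /comp_poly_X2_inj. Qed.

Lemma is_C0 : is_C 0 0.
Proof.
rewrite /is_C muln0 expr0 mulr1 comp_poly0 mulr0 /= U_add.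
rewrite (U_Xn (@Ordinal 4 2 isT)) (U_Xn (@Ordinal 4 1 isT)) /Ubasis /=.
by apply: (@eq_mod2 _ _ ('X^2 + 'X)); ring.
Qed.

Lemma is_C1 : is_C 1 1.
Proof.
rewrite /is_C /= comp_polyC mulr1.
(* Since f_1 = G, the result is F + G, which is r^2 + r mod 2. *)
have ->: ('X^2 + 'X) * 'X^(2 * 1) = G * 'X^0 :> {poly 'F_2} by rewrite /G; ring.
rewrite U_mulG (U_Xn (@Ordinal 4 0 isT)) /Ubasis /= /F /G.
by apply: (@eq_mod2 _ _ ('X^4 + 2 * 'X^3 + 'X^2)); ring.
Qed.

Lemma is_C2 : is_C 2 'X.
Proof.
rewrite /is_C /= comp_polyX.
have ->: ('X^2 + 'X) * 'X^(2 * 2) = G * 'X^2 :> {poly 'F_2} by rewrite /G; ring.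
rewrite U_mulG (U_Xn (@Ordinal 4 2 isT)) /Ubasis /= /F /G.
by apply: (@eq_mod2 _ _ ('X^2 * ('X^4 + 2 * 'X^3 + 'X^2))); ring.
Qed.

Lemma is_C3 : is_C 3 'X^2.
Proof.
rewrite /is_C /= comp_Xn_poly.
(* f_3 = G r^4, but r^4 is not a digit; mod 2 it equals G + r^3, and [U] turns out to fix it. *)
have ->: ('X^2 + 'X) * 'X^(2 * 3) = G * (G * 'X^0 + 'X^3) :> {poly 'F_2}.
  by apply: (@eq_mod2 _ _ (- ('X^3 * G))); rewrite /G; ring.
rewrite U_mulG U_add U_mulG (U_Xn (@Ordinal 4 0 isT)) (U_Xn (@Ordinal 4 3 isT)).
rewrite /Ubasis /=.
have ->: F * 1 + ('X^3 + 'X^2 + 'X) = 'X^4.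
  by apply: (@eq_mod2 _ _ (2 * 'X^3 + 2 * 'X^2 + 'X)); rewrite /F; ring.
rewrite /F /G.
by apply: (@eq_mod2 _ _ ('X^8 + 3 * 'X^7 + 'X^6 + 'X^6)); ring.
Qed.

Lemma is_C_rec n C D : is_C n C -> is_C (n + 3) D ->
  is_C (n + 4) (D + ('X^4 + 'X^3 + 'X^2 + 'X) * C + 'X^n * ('X^2 + 'X)).
Proof.
rewrite /is_C /= => hC hD.
set f := (_ * 'X^(2 * n)) in hC.
have {}hC: U f = ('X^2 + 'X) * (C \Po 'X^2) + f.
  by apply: (@eq_mod2 _ _ (- f)); rewrite -hC; ring.
have ->: ('X^2 + 'X) * 'X^(2 * (n + 4)) =
         ('X^2 + 'X) * 'X^(2 * (n + 3)) + G * (G * f) :> {poly 'F_2}.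
  apply: (@eq_mod2 _ _ (- ('X^7 * f + 'X^6 * f))).
  by rewrite /G /f !mulnDr !exprD; ring.
rewrite U_add !U_mulG addrACA hD hC.
rewrite !(comp_polyD, comp_polyM, comp_Xn_poly, comp_polyX) -exprM /f.
(* The two rows are half of F^2 - (r^8 + r^6 + r^4 + r^2) and half of F^2 + G^2 - (r^4 + r^2),
   expanded over the integers. *)
apply: (@eq_mod2 _ _ (('X^2 + 'X) *
  ((3 * 'X^7 + 7 * 'X^6 + 10 * 'X^5 + 7 * 'X^4 + 3 * 'X^3) * (C \Po 'X^2) +
   ('X^8 + 4 * 'X^7 + 8 * 'X^6 + 10 * 'X^5 + 7 * 'X^4 + 3 * 'X^3) * 'X^(2 * n)))).
by rewrite /F /G; ring.
Qed.

Lemma is_C_exists n : exists C, is_C n C.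
Proof.
elim/ltn_ind: n => -[|[|[|[|n]]]] IH.
- by exists 0; apply: is_C0.
- by exists 1; apply: is_C1.
- by exists 'X; apply: is_C2.
- by exists 'X^2; apply: is_C3.
(* The recursion looks back four steps and one step; the terms given to [IH] prove n < n + 4 and n +
   3 < n + 4. *)
have [C hC] := IH n (leq_addl 3 n.+1).
have [D hD] := IH (n + 3)%N (eq_leq (congr1 succn (addn3 n))).
by rewrite -addn4; exact: ex_intro (is_C_rec hC hD).
Qed.

Theorem theorem1p8 :
  (forall n : nat, exists! C : {poly 'F_2},
     (U \+ id) (('X^2 + 'X) * 'X^(2 * n)) = ('X^2 + 'X) * (C \Po 'X^2)) /\
  (forall C : nat -> {poly 'F_2},
     (forall n : nat,
        (U \+ id) (('X^2 + 'X) * 'X^(2 * n)) =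
        ('X^2 + 'X) * (C n \Po 'X^2)) ->
     (forall n : nat,
        C (n + 4)%N = C (n + 3)%N + ('X^4 + 'X^3 + 'X^2 + 'X) * C n
                      + 'X^n * ('X^2 + 'X)) /\
     [/\ C 0%N = 0, C 1%N = 1, C 2%N = 'X & C 3%N = 'X^2]).
Proof.
split=> [n | C hC].
  have [C hC] := is_C_exists n.
  by exists C; split=> // D; apply: is_C_inj hC.
split=> [n|].
  exact: is_C_inj (hC _) (is_C_rec (hC n) (hC (n + 3)%N)).
split.
- exact: is_C_inj (hC 0%N) is_C0.
- exact: is_C_inj (hC 1%N) is_C1.
- exact: is_C_inj (hC 2%N) is_C2.
- exact: is_C_inj (hC 3%N) is_C3.
Qed.
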